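(* Let $f:\mathbb{R}\to\mathbb{R}$ be a concave function, let $a>0$ be a real number and $\mu\ge 1$ an integer, and let $\mathcal{X}_1=\{(w,x)\in\mathbb{R}\times\mathbb{Z} : w\le f(ax),\ 0\le x\le\mu\}$. Let $$Q=\left\{(w,x)\in\mathbb{R}^2 : w\le [f(ka)-f((k-1)a)](x-k)+f(ka)\ \text{ for all } k\in\{1,\dots,\mu\},\ 0\le x\le\mu\right\}.$$ Then $\operatorname{conv}(\mathcal{X}_1)=Q$.
   Context: $\operatorname{conv}$ denotes the convex hull in $\mathbb{R}^2$. *)

(* Defs.v *)
From HB Require Import structures.
From mathcomp Require Import all_boot all_order all_algebra.
From mathcomp Require Import interval_inference.
From mathcomp Require Import boolp classical_sets reals convex.

Set Implicit Arguments.
Unset Strict Implicit.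
Unset Printing Implicit Defensive.

Import Order.TTheory GRing.Theory Num.Theory.

Local Open Scope classical_set_scope.
Local Open Scope ring_scope.
Local Open Scope convex_scope.

(* Mirrors [convex_function] of the library, with the inequality reversed. *)
Definition concave_function (R : numFieldType) (E : lmodType R)
    (E' := convex_lmodType E) (D : set E') (f : E' -> R^o) :=
  forall (t : {i01 R}),
    {in D &, forall (x y : E'), (f x <| t |> f y <= f (x <| t |> y))%R}.

(* The intersection of all the convex sets that contain [A]. *)
Definition convex_hull (R : numDomainType) (M : lmodType R) (A : set M) :
    set M :=
  smallest (@convex_set R M) A.

Definition plane (R : realType) : lmodType R := (R^o * R^o)%type.

Definition mixed_to_plane (R : realType) (p : R * int) : plane R :=
  (p.1, p.2%:~R).

Definition mixed_hypograph (R : realType) (f : R -> R) (a : R) (mu : int) :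
    set (R * int) :=
  [set p | p.1 <= f (a * p.2%:~R) /\ 0 <= p.2 <= mu].

Definition secant_polyhedron (R : realType) (f : R -> R) (a : R) (mu : int) :
    set (plane R) :=
  [set p : R * R |
    (forall k : int, 1 <= k <= mu ->
      p.1 <= (f (k%:~R * a) - f ((k - 1)%:~R * a)) * (p.2 - k%:~R)
             + f (k%:~R * a))
    /\ 0 <= p.2 <= mu%:~R].

(* Main.v *)
(* A concave function lies below each of its secants outside the two nodes, so
   every point of the mixed-integer hypograph satisfies all the secant
   inequalities.  Conversely, if k - 1 <= x <= k, the k-th inequality says that
   (w, x) lies at or below the segment joining the graph points over k - 1 and
   k; translating that segment vertically onto (w, x) keeps its endpoints in the
   mixed-integer hypograph. *)
Require Import Defs.
From HB Require Import structures.
From mathcomp Require Import all_boot all_order all_algebra.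
From mathcomp Require Import interval_inference.
From mathcomp Require Import boolp classical_sets reals convex.
From mathcomp Require Import zify ring lra.

Import Order.TTheory GRing.Theory Num.Theory.

Local Open Scope classical_set_scope.
Local Open Scope ring_scope.

Lemma concave_function_conv (R : realFieldType) (f : R -> R) (x y t : R) :
  @concave_function R R^o setT f -> 0 <= t -> t <= 1 ->
  t * f x + (1 - t) * f y <= f (t * x + (1 - t) * y).
Proof.
by move=> fc t0 t1; exact: (fc (Itv01 t0 t1) x y (in_setT _) (in_setT _)).
Qed.

(** [y] is the convex combination of [x] and [z] with weight [(z - y) / (z - x)] on [x]. Clearing
    the denominator lets the form cover the degenerate case [x = z] too. *)
Lemma concave_function_le_chord (R : realFieldType) (f : R -> R) (x y z : R) :
  @concave_function R R^o setT f -> x <= y -> y <= z ->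
  (z - y) * f x + (y - x) * f z <= (z - x) * f y.
Proof.
move=> fc xy yz; have [xz|xz] := eqVneq x z.
  by have -> : y = x; [lra | rewrite -xz subrr !mul0r addr0].
have zx_gt0 : 0 < z - x by rewrite subr_gt0 lt_neqAle xz; apply: le_trans yz.
have t0 : 0 <= (z - y) / (z - x).
  by apply: divr_ge0 (ltW zx_gt0); rewrite subr_ge0.
have t1 : (z - y) / (z - x) <= 1.
  by rewrite ler_pdivrMr// mul1r lerD2l lerN2.
have := concave_function_conv _ _ x z _ fc t0 t1.
have -> : (z - y) / (z - x) * x + (1 - (z - y) / (z - x)) * z = y.
  by field; rewrite lt0r_neq0.
rewrite -(ler_pM2l zx_gt0); apply: le_trans.
rewrite le_eqVlt; apply/orP; left; apply/eqP.
by field; rewrite lt0r_neq0.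
Qed.

(** Rearranges the chord inequality for the triple [z, u, v] or [u, v, z]: the middle point is a
    node of the secant, and [z] is an end. *)
Lemma concave_function_le_secant (R : realFieldType) (f : R -> R) (u v z : R) :
  @concave_function R R^o setT f -> u < v -> z <= u \/ v <= z ->
  (v - u) * (f z - f v) <= (f v - f u) * (z - v).
Proof.
move=> fc /ltW uv [zu|vz].
- have := concave_function_le_chord _ _ _ _ _ fc zu uv; lra.
- have := concave_function_le_chord _ _ _ _ _ fc uv vz; lra.
Qed.

Lemma conv_plane (R : realType) (t : {i01 R})
    (p q : convex_lmodType (plane R)) :
  conv t p q = (t%:num * p.1 + (1 - t%:num) * q.1,
                t%:num * p.2 + (1 - t%:num) * q.2).
Proof. by []. Qed.

Lemma convex_set_halfplane (R : realType) (c b : R) :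
  @convex_set R (plane R) [set p : R * R | p.1 <= c * p.2 + b].
Proof.
move=> x y t /set_mem /= hx /set_mem /= hy.
rewrite conv_plane; apply/mem_set => /=.
have t0 : 0 <= t%:num by [].
have t1 : 0 <= 1 - t%:num by rewrite subr_ge0.
have := ler_wpM2l t0 hx; have := ler_wpM2l t1 hy.
lra.
Qed.

Lemma convex_set_secant_polyhedron (R : realType) (f : R -> R) (a : R)
    (mu : int) :
  @convex_set R (plane R) (secant_polyhedron f a mu).
Proof.
move=> x y t /set_mem /= [hx /andP[x0 x1]] /set_mem /= [hy /andP[y0 y1]].
apply/mem_set; split=> [k hk|].
- set c := f _ - f _; set b := f _.
  (* Slope-intercept form of the [k]-th line: the intercept is [b - c * k]. *)
  have H := @convex_set_halfplane R c (b - c * k%:~R) x y t.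
  have -> : c * ((conv t x y).2 - k%:~R) + b
      = c * (conv t x y).2 + (b - c * k%:~R) by ring.
  apply/set_mem/H; apply/mem_set => /=.
  + by have := hx k hk; rewrite -/c -/b; lra.
  + by have := hy k hk; rewrite -/c -/b; lra.
- have t0 : 0 <= t%:num by [].
  have t1 : 0 <= 1 - t%:num by rewrite subr_ge0.
  rewrite conv_plane /=; apply/andP; split; nra.
Qed.

Lemma mixed_hypograph_sub_secant_polyhedron (R : realType) (f : R -> R) (a : R)
    (mu : int) :
  @concave_function R R^o setT f -> 0 < a ->
  @mixed_to_plane R @` mixed_hypograph f a mu `<=` secant_polyhedron f a mu.
Proof.
move=> fc a_gt0 _ [[w x] /= [hw /andP[x0 xmu]] <-]; split=> /= [k _|].
- apply: le_trans hw _.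
  have kE : (k - 1)%:~R = k%:~R - 1 :> R by rewrite intrB.
  have uv : (k - 1)%:~R * a < k%:~R * a by rewrite ltr_pM2r// ltr_int; lia.
  (* Integrality enters here: no integer lies strictly between [k - 1] and [k], so [a * x] avoids
     the open interval between the nodes. *)
  have /(concave_function_le_secant _ _ _ _ _ fc uv) :
      a * x%:~R <= (k - 1)%:~R * a \/ k%:~R * a <= a * x%:~R.
    rewrite ![_ * a]mulrC !ler_pM2l// !ler_int.
    by case: (lerP k x) => ?; [right | left; lia].
  have -> : k%:~R * a - (k - 1)%:~R * a = a by rewrite kE; ring.
  have -> : a * x%:~R - k%:~R * a = a * (x%:~R - k%:~R) by ring.
  (* Both sides now carry the factor [a], the node spacing, which cancels. *)
  by rewrite mulrCA ler_pM2l// lerBlDr.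
- by rewrite ler_int xmu ler0z x0.
Qed.

Lemma unit_interval_between_integers (R : realType) (mu : int) (x : R) :
  1 <= mu -> 0 <= x <= mu%:~R ->
  exists2 k : int, 1 <= k <= mu & (k - 1)%:~R <= x <= k%:~R.
Proof.
move=> mu1 /andP[]; rewrite le_eqVlt => /predU1P[<- _|x_gt0 xmu].
  (* At [x = 0] the ceiling is 0, below the admissible range, so the first interval is chosen. *)
  by exists 1; rewrite ?subrr ?lexx ?ler01 ?mu1.
exists (Num.ceil x); last by rewrite ceil_ge (ltW (ceilB1_lt _)).
by rewrite ceil_le_int xmu -gtz0_ge1 ceil_gt0 x_gt0.
Qed.

Lemma secant_polyhedron_sub_convex_hull (R : realType) (f : R -> R) (a : R)
    (mu : int) :
  1 <= mu ->
  secant_polyhedron f a mu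
    `<=` convex_hull (@mixed_to_plane R @` mixed_hypograph f a mu).
Proof.
(* Membership in the hull is tested against an arbitrary convex [A] containing the mixed-integer
   points. *)
move=> mu1 [w x] [/= hs hx] A [Aconv subA].
have [k /andP[k1 kmu] /andP[xl xr]] :=
  unit_interval_between_integers _ _ _ mu1 hx.
have kE : (k - 1)%:~R = k%:~R - 1 :> R by rewrite intrB.
(* [L] is the height over [x] of the line through the nodes [k - 1] and [k]; [d] below is the
   vertical shift from it to [w]. *)
set L := (f (k%:~R * a) - f ((k - 1)%:~R * a)) * (x - k%:~R) + f (k%:~R * a).
have wL : w <= L by apply: hs; rewrite k1.
set d := w - L.
have d_le0 : d <= 0 by rewrite subr_le0.
have node_in (j : int) : 0 <= j <= mu ->
    ((f (j%:~R * a) + d, j%:~R) : plane R) \in A.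
  move=> hj; apply/mem_set/subA; exists (f (j%:~R * a) + d, j) => //=.
  by split=> //=; rewrite [a * _]mulrC gerDl.
have t0 : 0 <= k%:~R - x by rewrite subr_ge0.
have t1 : k%:~R - x <= 1 by rewrite kE in xl; lra.
(* The node over [k - 1] gets weight [k - x], its distance from [x] to the opposite end; the common
   shift [d] survives the averaging. *)
have -> : (w, x) = conv (Itv01 t0 t1)
    ((f ((k - 1)%:~R * a) + d, (k - 1)%:~R) : convex_lmodType (plane R))
    ((f (k%:~R * a) + d, k%:~R) : convex_lmodType (plane R)).
  by rewrite conv_plane /=; congr pair; rewrite ?/d ?/L ?kE; ring.
by apply/set_mem/Aconv; apply: node_in; lia.
Qed.

Theorem proposition2p4 (R : realType) (f : R -> R) (a : R) (mu : int)
    (f_concave : @concave_function R R^o setT f)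
    (a_gt0 : 0 < a) (mu_ge1 : 1 <= mu) :
  convex_hull (@mixed_to_plane R @` mixed_hypograph f a mu)
  = secant_polyhedron f a mu.
Proof.
apply/seteqP; split; last exact: secant_polyhedron_sub_convex_hull.
(* By minimality of the hull, it suffices that the polyhedron is convex and contains the points. *)
apply: smallest_sub; first exact: convex_set_secant_polyhedron.
exact: mixed_hypograph_sub_secant_polyhedron.
Qed.
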